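(* There is a universal constant $C>0$ such that the following holds. Let $l\le m$ be two positive integers and let $\sigma>0$. Take any $\delta\ge 0$ and let \[ s:=\frac{\delta(\sqrt{l}+\sqrt{m})}{lm\sigma}. \] Suppose that $2/l\le s\le 1$. For an $l\times m$ real matrix $M=(\mu_{ij})$, let $Y=(y_{ij})$ be an $l\times m$ random matrix with independent entries, $y_{ij}$ being normally distributed with mean $\mu_{ij}$ and variance $\sigma^2$. Let $\tilde M$ be any estimate of $M$ based on $Y$ (that is, an $\mathbb{R}^{l\times m}$-valued measurable function of $Y$). Then there exists an $l\times m$ matrix $M$ with $\|M\|_*\le\delta$, such that if this is the true $M$, then \[ \frac{\mathbb{E}\|\tilde M-M\|_{\mathrm{HS}}^2}{lm\sigma^2}\ge Cs. \]
   Context: For $A=(a_{ij})\in\mathbb{R}^{l\times m}$ with singular values $s_1,\dots,s_k$, $k=\min\{l,m\}$, the Hilbert--Schmidt norm is $\|A\|_{\mathrm{HS}}=\bigl(\sum_{i,j}a_{ij}^2\bigr)^{1/2}=\bigl(\sum_{i=1}^k s_i^2\bigr)^{1/2}$ and the nuclear norm is $\|A\|_*=\sum_{i=1}^k s_i$. The matrix $M$ whose existence is asserted may depend on the estimator $\tilde M$ and on $l,m,\sigma,\delta$; the constant $C$ depends on nothing. *)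

(* Defs.v *)
From HB Require Import structures.
From mathcomp Require Import all_boot all_order all_algebra.
From mathcomp Require Import polyrcf.
From mathcomp Require Import all_classical all_reals all_analysis.

Set Implicit Arguments.
Unset Strict Implicit.
Unset Printing Implicit Defensive.

Import Order.TTheory GRing.Theory Num.Theory.
Import numFieldNormedType.Exports.

Local Open Scope classical_set_scope.
Local Open Scope ring_scope.

Section matrix_norms.
Context {R : rcfType} {l m : nat}.
Implicit Type A : 'M[R]_(l, m).

Definition hs_norm A : R := Num.sqrt (\sum_(i < l) \sum_(j < m) A i j ^+ 2).

(* Using the smaller of the two Gram matrices makes the list of singular      *)
(* values have length exactly minn l m.                                       *)
Definition gram_char_poly A : {poly R} :=
  if (l <= m)%N then char_poly (A *m A^T) else char_poly (A^T *m A).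

(* Square roots of the eigenvalues of the Gram matrix, each repeated          *)
(* according to its multiplicity as a root of the characteristic polynomial.  *)
Definition singular_values A : seq R :=
  let p := gram_char_poly A in
  flatten [seq nseq (mup x p) (Num.sqrt x) | x <- rootsR p].

Definition nuclear_norm A : R := \sum_(s <- singular_values A) s.

End matrix_norms.

(* Matrices carry the product sigma-algebra, i.e. the one generated by the    *)
(* entries (as for n.-tuple T in the library); over the reals this is the     *)
(* Borel sigma-algebra of R^(l x m).                                          *)
Definition measure_matrix_display : measure_display -> measure_display.
Proof. exact. Qed.

Section measurable_matrix.
Context {d} {T : measurableType d} (l m : nat).

Definition matrix_measurable : set (set 'M[T]_(l, m)) :=
  <<s [set B | exists i j,
        preimage_set_system setT (fun N : 'M[T]_(l, m) => N i j) measurable B] >>.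

Let matrix_measurable0 : matrix_measurable set0.
Proof. exact: sigma_algebra0. Qed.

Let matrix_measurableC A : matrix_measurable A -> matrix_measurable (~` A).
Proof. exact: sigma_algebraC. Qed.

Let matrix_measurable_bigcup (F : (set 'M[T]_(l, m))^nat) :
  (forall i, matrix_measurable (F i)) -> matrix_measurable (\bigcup_i F i).
Proof. exact: sigma_algebra_bigcup. Qed.

HB.instance Definition _ := @isMeasurable.Build (measure_matrix_display d)
  'M[T]_(l, m) matrix_measurable
  matrix_measurable0 matrix_measurableC matrix_measurable_bigcup.

End measurable_matrix.

Section gaussian_matrix.
Context {d} {Omega : measurableType d} {R : realType} (P : probability Omega R).

Definition mutually_independent {d'} {T : measurableType d'} {I : finType}
    (X : I -> Omega -> T) : Prop :=
  forall (J : {set I}) (A : I -> set T), (forall i, measurable (A i)) ->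
    P (\bigcap_(i in [set` J]) (X i @^-1` A i)) =
    (\prod_(i in J) P (X i @^-1` A i))%E.

Definition normal_rv (mu sigma : R) (X : Omega -> R) : Prop :=
  forall A : set R, measurable A -> P (X @^-1` A) = normal_prob mu sigma A.

Definition gaussian_matrix {l m : nat} (M : 'M[R]_(l, m)) (sigma : R)
    (Y : {RV P >-> 'M[R]_(l, m)}) : Prop :=
  mutually_independent (fun (ij : 'I_l * 'I_m) w => Y w ij.1 ij.2) /\
  forall i j, normal_rv (M i j) sigma (fun w => Y w i j).

End gaussian_matrix.

(* Main.v *)
Require Import Defs.
From HB Require Import structures.
From mathcomp Require Import all_boot all_order all_algebra.
From mathcomp Require Import complex polyrcf spectral.
From mathcomp Require Import all_classical all_reals all_analysis.
From mathcomp Require Import measurable_realfun ring lra.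

(* A minimax lower bound by two-point tests.  Put k = floor(s l / 2) and let  *)
(* M range over the matrices whose first k rows have entries +sigma or -sigma *)
(* and whose other rows vanish.  Such M has rank at most k, so by Cauchy-     *)
(* Schwarz on the singular values its nuclear norm is at most k sqrt(m) sigma *)
(* <= delta. For one entry of the first k rows, the laws of Y for the two     *)
(* signs of that entry are mutually comparable on the event |y_ij| <= sigma,  *)
(* of probability bounded below; hence the sign of the estimate of mu_ij is   *)
(* wrong with probability bounded below on average over the two signs.        *)
(* Averaging over all sign patterns yields one pattern for which the expected *)
(* number of wrong signs is at least of order k m, and each wrong sign costs  *)
(* sigma^2.                                                                   *)

Set Implicit Arguments.
Unset Strict Implicit.
Unset Printing Implicit Defensive.

Import Order.TTheory GRing.Theory Num.Theory.
Import numFieldNormedType.Exports.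

Local Open Scope classical_set_scope.
Local Open Scope ring_scope.

(** The entries of a sign pattern sit exactly at noise level, so no estimator can recover more than
    a constant fraction of the signs, and the loss is of the order of [n * m * sigma ^+ 2] for [n]
    nonzero rows. The constraint allows [n] of order [s * l]: since
    [Num.sqrt l%:R <= Num.sqrt m%:R], the definition of [s] gives
    [s * l * Num.sqrt m * sigma <= 2 * delta].

    The constraint rests on [nuclear_norm_le_rank]. The indistinguishability of two opposite signs
    is [two_point_error], obtained by resampling one entry ([gaussian_law_resample]);
    [exists_wrong_signs] averages it over all patterns, and [risk_wrong_sign] turns wrong signs into
    squared error. *)

(** * Spectra of symmetric matrices; nuclear norm, rank and Hilbert-Schmidt norm *)

Lemma char_poly_conj (F : fieldType) n (P D : 'M[F]_n) : P \in unitmx ->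
  char_poly (invmx P *m D *m P) = char_poly D.
Proof.
move=> Pu; rewrite /char_poly /char_poly_mx.
have -> : 'X%:M - map_mx polyC (invmx P *m D *m P) =
  map_mx polyC (invmx P) *m ('X%:M - map_mx polyC D) *m map_mx polyC P.
  rewrite mulmxBr mulmxBl !map_mxM; congr (_ - _).
  by rewrite -mulmxA -scalar_mxC mulmxA -map_mxM mulVmx// map_mx1 mul1mx.
rewrite !det_mulmx mulrAC -det_mulmx -map_mxM mulVmx//.
by rewrite map_mx1 det1 mul1r.
Qed.

(** Selecting the nonzero entries and dividing by them factors an identity matrix of that size
    through [diag_mx d]. *)
Lemma leq_card_mxrank_diag (F : fieldType) n (d : 'rV[F]_n) :
  (#|[pred i | d 0%R i != 0%R]| <= \rank (diag_mx d))%N.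
Proof.
set A := [pred i | _]; set c := #|A|.
pose C : 'M[F]_(c, n) := \matrix_(a, j) (enum_val a == j)%:R.
pose E : 'M[F]_(n, c) := \matrix_(j, b) ((j == enum_val b)%:R / d 0 j).
have CDE : C *m diag_mx d *m E = 1%:M.
  apply/matrixP => a b; rewrite mxE (bigD1 (enum_val a))//= big1 => [|j ja].
    rewrite mul_mx_diag !mxE eqxx mul1r addr0 mulrC mulfVK 
      ?(inj_eq enum_val_inj)//.
    by have := enum_valP a; rewrite inE.
  by rewrite mul_mx_diag !mxE eq_sym (negPf ja) !mul0r.
rewrite -[leqLHS](mxrank1 F) -CDE (leq_trans (mxrankM_maxl _ _))//.
exact: mxrankM_maxr.
Qed.

(** Over [R[i]] the matrix is hermitian, so the spectral theorem diagonalises it with real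
    eigenvalues; each claim then descends along the embedding of [R]. *)
Lemma symmetric_spectrum (R : rcfType) n (G : 'M[R]_n) : G^T = G ->
  exists d : 'rV[R]_n,
  [/\ char_poly G = \prod_(i < n) ('X - (d 0 i)%:P),
      (#|[pred i | d 0%R i != 0%R]| <= \rank G)%N & \tr G = \sum_(i < n) d 0 i].
Proof.
move=> Gsym; pose f := real_complex R; pose Gc := map_mx f G.
have Gr : Gc \is a mxOver Num.real.
  by apply/mxOverP => i j; rewrite mxE; apply/complex_realP; exists (G i j).
have Gh : Gc \is hermsymmx.
  apply: realsym_hermsym => //; apply/is_hermitianmxP/matrixP => i j.
  by rewrite expr0 scale1r !mxE -[in LHS]Gsym mxE.
have /orthomx_spectralP := hermitian_normalmx Gh.
have /mxOverP dr := hermitian_spectral_diag_real Gh.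
have Pu := spectral_unit Gc.
set P := spectralmx Gc in Pu *; set D := spectral_diag Gc in dr * => GcE.
pose d : 'rV[R]_n := map_mx (@complex.Re R) D.
have DE : D = map_mx f d.
  by apply/rowP => i; rewrite !mxE; apply/esym/RRe_real/dr.
exists d; split.
- apply: (map_poly_inj f); rewrite map_char_poly -/Gc GcE char_poly_conj//.
  rewrite char_poly_trig ?diag_mx_is_trig// rmorph_prod; apply: eq_bigr => i _.
  by rewrite mxE eqxx mulr1n DE mxE rmorphB/= map_polyX map_polyC.
- rewrite -(mxrank_map f) -/Gc GcE mxrankMfree ?row_free_unit//.
  rewrite (eqmxMfull _ (_ : row_full _)) ?row_full_unit ?unitmx_inv//.
  rewrite DE -map_diag_mx mxrank_map; exact: leq_card_mxrank_diag.
- apply: (fmorph_inj f); rewrite -trace_map_mx -/Gc GcE mxtrace_mulC mulmxA.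
  rewrite mulmxV// mul1mx mxtrace_diag rmorph_sum.
  by apply: eq_bigr => i _; rewrite DE mxE.
Qed.

(** Cauchy-Schwarz against the constant 1, from Lagrange's identity: the sum of all
    [(a i - a j) ^+ 2] is twice the difference of the two sides. *)
Lemma sqr_sum_le_card (R : realFieldType) (I : finType) (S : {pred I})
    (a : I -> R) :
  (\sum_(i in S) a i) ^+ 2 <= #|S|%:R * \sum_(i in S) a i ^+ 2.
Proof.
have : 0 <= \sum_(i in S) \sum_(j in S) (a i - a j) ^+ 2.
  by apply: sumr_ge0 => i _; apply: sumr_ge0 => j _; exact: sqr_ge0.
have -> : \sum_(i in S) \sum_(j in S) (a i - a j) ^+ 2 =
    (#|S|%:R * \sum_(i in S) a i ^+ 2 - (\sum_(i in S) a i) ^+ 2) *+ 2.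
  have E i : \sum_(j in S) (a i - a j) ^+ 2 = #|S|%:R * a i ^+ 2 -
      (a i * \sum_(j in S) a j) *+ 2 + \sum_(j in S) a j ^+ 2.
    rewrite [a i * _]mulr_sumr -sumrMnl mulr_natl -sumr_const -sumrB -big_split.
    by apply: eq_bigr => j _; rewrite sqrrB.
  rewrite (eq_bigr _ (fun i _ => E i)) big_split sumrB /= -mulr_sumr sumrMnl.
  by rewrite -mulr_suml -expr2 sumr_const -mulr_natl mulr2n mulrnBl; ring.
by rewrite pmulrn_lge0// subr_ge0.
Qed.

(** At most [\rank A] singular values are nonzero, and their squares sum to the trace of [A *m A^T],
    which is [hs_norm A ^+ 2]; Cauchy-Schwarz concludes. *)
Lemma nuclear_norm_le_rank (R : rcfType) l m (A : 'M[R]_(l, m)) : (l <= m)%N ->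
  nuclear_norm A <= Num.sqrt (\rank A)%:R * hs_norm A.
Proof.
move=> lm; pose G := A *m A^T.
have [|d [Gd rd td]] := @symmetric_spectrum R l G; first
  by rewrite trmx_mul trmxK.
pose s := codom (d 0).
have ps : char_poly G = \prod_(x <- s) ('X - x%:P).
  by rewrite Gd big_map -big_enum.
have d_ge0 i : 0 <= d 0 i.
  (* For an eigenvector [v], the eigenvalue times [v *m v^T] equals [(v *m A) *m (v *m A)^T]. *)
  have /eigenvalueP[v vG v0] : eigenvalue G (d 0 i).
    by rewrite eigenvalue_root_char ps root_prod_XsubC codom_f.
  have sq_ge0 p (w : 'rV[R]_p) : 0 <= (w *m w^T) 0 0.
    by rewrite mxE sumr_ge0// => j _; rewrite mxE -expr2 sqr_ge0.
  have vv : 0 < (v *m v^T) 0 0.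
    rewrite lt_neqAle sq_ge0 andbT eq_sym; apply: contraNN v0 => /eqP.
    rewrite mxE => /psumr_eq0P vv0; apply/eqP/rowP => j.
    have /eqP : v 0 j * v^T j 0 = 0.
      by apply: vv0 => // k _; rewrite mxE -expr2 sqr_ge0.
    by rewrite !mxE mulf_eq0 orbb => /eqP.
  rewrite -(pmulr_lge0 _ vv); have := sq_ge0 _ (v *m A).
  by rewrite trmx_mul mulmxA -(mulmxA v) vG -scalemxAl mxE.
have -> : nuclear_norm A = \sum_(i < l) Num.sqrt (d 0 i).
  rewrite /nuclear_norm /singular_values /gram_char_poly lm -/G.
  set p := char_poly G in ps *.
  have p0 : p != 0 by rewrite monic_neq0 ?char_poly_monic.
  transitivity (\sum_(x <- s) Num.sqrt x); last by rewrite big_map -big_enum.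
  (* [rootsR] lists each root once, so the sum over [s] is grouped by distinct values, each counted
     with its multiplicity. *)
  rewrite big_flatten big_map /= -[RHS]big_undup_iterop_count.
  rewrite (perm_big (undup s)) /=.
    by apply: eq_bigr => x _; rewrite big_nseq ps mu_prod_XsubC Monoid.iteropE.
  apply: uniq_perm; rewrite ?undup_uniq ?uniq_roots// => x.
  have := roots_on_rootsR p0 x; rewrite in_itv/= mem_undup => <-.
  by rewrite ps root_prod_XsubC.
have -> : \sum_(i < l) Num.sqrt (d 0 i) =
    \sum_(i in [pred i | d 0 i != 0]) Num.sqrt (d 0 i).
  rewrite [LHS](bigID [pred i | d 0 i != 0])/= addrC big1 ?add0r// => i.
  by rewrite negbK => /eqP->; rewrite sqrtr0.
rewrite /hs_norm -sqrtrM ?ler0n// -ler_sqr ?nnegrE ?sqrtr_ge0//; last first.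
  by apply: sumr_ge0 => i _; rewrite sqrtr_ge0.
rewrite [leRHS]sqr_sqrtr; last first.
  rewrite mulr_ge0 ?ler0n// !sumr_ge0// => i _.
  by rewrite sumr_ge0// => j _; rewrite sqr_ge0.
apply: le_trans (sqr_sum_le_card _ _) _.
apply: ler_pM; rewrite ?ler0n ?ler_nat//.
- by rewrite sumr_ge0// => i _; rewrite sqr_ge0.
- by rewrite (leq_trans rd)// mxrankM_maxl.
- have -> : \sum_(i < l) \sum_(j < m) A i j ^+ 2 = \sum_(i < l) d 0 i.
    rewrite -td; apply: eq_bigr => i _; rewrite mxE; apply: eq_bigr => j _.
    by rewrite mxE expr2.
  rewrite [leRHS](bigID [pred i | d 0 i != 0])/= ler_wpDr//.
    exact: sumr_ge0.
  by apply: ler_sum => i _; rewrite sqr_sqrtr.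
Qed.

(** * Boxes as a generating pi-system of the matrix sigma-algebra *)

Section matrix_boxes.
Context {d} {T : measurableType d} {l m : nat}.

Definition box (A : 'I_l * 'I_m -> set T) : set 'M[T]_(l, m) :=
  [set N | forall k, A k (N k.1 k.2)].

Lemma measurable_mx_entry i j :
  measurable_fun setT (fun N : 'M[T]_(l, m) => N i j).
Proof.
move=> _ A mA; rewrite setTI; apply: sub_sigma_algebra.
by exists i, j, A => //; rewrite setTI.
Qed.

Lemma measurable_fun_mx d' (X : measurableType d') (f : X -> 'M[T]_(l, m)) :
  (forall i j, measurable_fun setT (fun x => f x i j)) -> measurable_fun setT f.
Proof.
move=> mf; apply: (@measurability _ _ _ _ _ _
  [set B | exists i j, preimage_set_system setT
    (fun N : 'M[T]_(l, m) => N i j) measurable B]) => //.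
move=> _ [_ [i [j [A mA <-]]] <-]; rewrite setTI.
exact: mf.
Qed.

Lemma measurable_box A : (forall k, measurable (A k)) -> measurable (box A).
Proof.
move=> mA; rewrite [box A](_ : _ =
  \bigcap_(k in [set: 'I_l * 'I_m])
    ((fun N : 'M[T]_(l, m) => N k.1 k.2) @^-1` A k)).
  apply: fin_bigcap_measurable => // k _; rewrite -[X in measurable X]setTI.
  exact: measurable_mx_entry.
by apply/seteqP; split => N NA k => [_|]; [exact: NA|exact: (NA k Logic.I)].
Qed.

Lemma eq_measure_box (R : realType)
    (mu nu : {measure set 'M[T]_(l, m) -> \bar R}) : (mu setT < +oo)%E ->
  (forall A, (forall k, measurable (A k)) -> mu (box A) = nu (box A)) ->
  forall B, measurable B -> mu B = nu B.
Proof.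
move=> muT mn B mB.
pose G := [set box A | A in [set A | forall k, measurable (A k)]].
have Gm : G `<=` measurable by move=> _ [A mA <-]; exact: measurable_box.
have setTE : setT = box (fun=> setT) by apply/seteqP; split.
apply: (measure_unique G (fun=> setT)) => //.
- apply/seteqP; split; last first.
    by apply: smallest_sub => //; exact: sigma_algebra_measurable.
  apply: smallest_sub; first exact: smallest_sigma_algebra.
  move=> _ [i [j [A mA <-]]]; apply: sub_sigma_algebra.
  exists (fun k => if k == (i, j) then A else setT) => [k|].
    by case: ifP.
  rewrite setTI; apply/seteqP; split => N /=.
    by move=> /(_ (i, j)); rewrite eqxx.
  by move=> NA k; case: eqP => // ->.
- move=> _ _ [A mA <-] [A' mA' <-]; exists (fun k => A k `&` A' k) => [k|].
    exact: measurableI.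
  apply/seteqP; split => N /=; first by move=> h; split => k; case: (h k).
  by move=> [h h'] k; split.
- by move=> _; exists (fun=> setT).
- by rewrite bigcup_const//; exists 0%N.
- by move=> _ [A mA <-]; exact: mn.
Qed.

End matrix_boxes.

(** * Gaussian laws on matrices and resampling of one entry *)

Section gaussian_law.
Context {R : realType} {l m : nat}.
Implicit Types (M : 'M[R]_(l, m)) (sigma : R).

(** Independence and normality as a product formula on boxes, which determines the law by
    [eq_measure_box] and no longer mentions [Omega]. This matters because [M] must be chosen before
    the probability space. *)
Definition gaussian_law M sigma (mu : set 'M[R]_(l, m) -> \bar R) :=
  forall A, (forall k, measurable (A k)) ->
  mu (box A) = (\prod_k normal_prob (M k.1 k.2) sigma (A k))%E.

Lemma gaussian_matrix_law d (Omega : measurableType d) (P : probability Omega R)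
    (Y : {RV P >-> 'M[R]_(l, m)}) M sigma :
  gaussian_matrix M sigma Y -> gaussian_law M sigma (distribution P Y).
Proof.
move=> [indY normY] A mA; have := indY [set: 'I_l * 'I_m]%SET A mA.
rewrite /distribution /pushforward => indYA.
transitivity (P (\bigcap_(i in [set` [set: 'I_l * 'I_m]%SET])
    ((fun w => Y w i.1 i.2) @^-1` A i))).
  congr (P _); apply/seteqP; split => w /= YA k //.
    by move=> _; exact: YA.
  by apply: YA => /=; rewrite inE.
rewrite indYA; apply: eq_big => [k|k _]; first by rewrite inE.
exact: normY.
Qed.

Definition set_entry i j (xN : measurableTypeR R * 'M[R]_(l, m)) :
    'M[R]_(l, m) :=
  \matrix_(i', j') if (i', j') == (i, j) then xN.1 else xN.2 i' j'.

Lemma measurable_set_entry i j : measurable_fun setT (set_entry i j).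
Proof.
apply: measurable_fun_mx => i' j'.
have [ij|ij] := eqVneq (i', j') (i, j).
  rewrite (_ : (fun _ => _) = fst); first exact: measurable_fst.
  by apply/funext => x; rewrite mxE ij eqxx.
rewrite (_ : (fun _ => _) = (fun N : 'M[R]_(l, m) => N i' j') \o snd).
  by apply: measurableT_comp => //; exact: measurable_mx_entry.
by apply/funext => x; rewrite mxE (negPf ij).
Qed.

(* Replacing the entry (i, j) by an independent normal variable of mean M' i  *)
(* j turns the law of mean M into that of mean M'.                            *)
Lemma gaussian_law_resample i j M M' sigma
    (mu mu' : probability 'M[R]_(l, m) R) :
  (forall k, k != (i, j) -> M k.1 k.2 = M' k.1 k.2) ->
  gaussian_law M sigma mu -> gaussian_law M' sigma mu' ->
  forall B, measurable B ->
  mu' B = (\int[mu]_N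
    normal_prob (M' i j) sigma (ysection (set_entry i j @^-1` B) N))%E.
Proof.
move=> MM' muM muM' B mB.
pose mphi := measurable_set_entry i j.
pose phi : {mfun (measurableTypeR R * 'M[R]_(l, m))%type >-> 'M[R]_(l, m)} :=
  HB.pack (set_entry i j) (isMeasurableFun.Build _ _ _ _ _ mphi).
(* The integral is by definition the mass of [B] under the image of a product measure, so the two
   laws need comparing on boxes only. *)
transitivity (pushforward (normal_prob (M' i j) sigma \x^ mu)%E phi B);
  last by [].
apply: eq_measure_box => //.
  exact: le_lt_trans (probability_le1 mu' measurableT) (ltry 1).
move=> A mA; apply: (etrans (muM' A mA)); apply/esym.
change ((normal_prob (M' i j) sigma \x^ mu)%E (phi @^-1` box A) =
  (\prod_k normal_prob (M' k.1 k.2) sigma (A k))%E).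
(* The old entry at [(i, j)] is overwritten, hence unconstrained in [A']. *)
pose A' k := if k == (i, j) then setT else A k.
have mA' k : measurable (A' k) by rewrite /A'; case: ifP.
have -> : phi @^-1` box A = A (i, j) `*` box A'.
  apply/seteqP; split => -[x N] /=.
    move=> h; split=> [|k]; first by have := h (i, j); rewrite mxE eqxx.
    rewrite /A'; case: eqP => // /eqP kij; have := h k.
    by rewrite mxE -surjective_pairing (negPf kij).
  move=> [Ax h] k; rewrite mxE -surjective_pairing.
  case: eqP => [->//|/eqP kij].
  by have := h k; rewrite /A' (negPf kij).
have mAij : measurable (A (i, j) : set (measurableTypeR R)) := mA (i, j).
rewrite [LHS](product_measure2E _ _ mAij (measurable_box mA')).
rewrite [X in (_ * X)%E = _]muM// (bigD1 (i, j))//=.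
rewrite [in RHS](bigD1 (i, j))//= /A' eqxx.
rewrite [X in (_ * (X * _))%E = _]probability_setT mul1e; congr (_ * _)%E.
by apply: eq_bigr => k kij; rewrite (negPf kij) MM'.
Qed.

End gaussian_law.

(** * Normal densities on [[- sigma, sigma]] *)

Lemma normal_pdf_lb (R : realType) (b sigma x : R) : 0 < sigma ->
  `|b| <= sigma -> `|x| <= sigma ->
  expR (- 2) * normal_peak sigma <= normal_pdf b sigma x.
Proof.
move=> s0 bs xs; rewrite normal_pdfE ?gt_eqF// mulrC.
rewrite ler_wpM2l ?normal_peak_ge0//.
rewrite ler_expR mulNr lerN2 ler_pdivrMr ?mulrn_wgt0 ?exprn_gt0//.
(* Then [(x - b) ^+ 2 / (2 * sigma ^+ 2)] is at most 2, whence [expR (- 2)]. *)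
have xb : `|x - b| <= sigma *+ 2.
  by rewrite (le_trans (ler_normB _ _))// mulr2n lerD.
have : `|x - b| ^+ 2 <= (sigma *+ 2) ^+ 2.
  by rewrite lerXn2r ?nnegrE// mulrn_wge0// ltW.
by rewrite real_normK ?num_real//; lra.
Qed.

Lemma le_normal_prob (R : realType) (a b sigma : R) (A : set R) : 0 < sigma ->
  `|b| <= sigma -> measurable A -> A `<=` `[- sigma, sigma] ->
  ((expR (- 2))%:E * normal_prob a sigma A <= normal_prob b sigma A)%E.
Proof.
move=> s0 bs mA As; rewrite /normal_prob.
have mpdf c : measurable_fun A (EFin \o normal_pdf c sigma).
  apply: measurable_funTS; apply/measurable_EFinP; exact: measurable_normal_pdf.
rewrite -ge0_integralZl//; first last.
- by move=> x _; rewrite lee_fin normal_pdf_ge0.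
- exact: mpdf.
apply: ge0_le_integral => //.
- by move=> x _; rewrite mule_ge0// lee_fin ?normal_pdf_ge0 ?expR_ge0.
- apply: emeasurable_funM => //; exact: mpdf.
- exact: mpdf.
- move=> x /As; rewrite /= in_itv/= -ler_norml => xs; rewrite -EFinM lee_fin.
  apply: le_trans (normal_pdf_lb s0 bs xs).
  by rewrite ler_wpM2l ?expR_ge0// normal_pdf_ub// gt_eqF.
Qed.

Lemma normal_prob_ball (R : realType) (b sigma : R) : 0 < sigma ->
  `|b| <= sigma ->
  ((2 * expR (- 2) / Num.sqrt (pi *+ 2))%:E <=
   normal_prob b sigma `[(- sigma)%R, sigma])%E.
Proof.
move=> s0 bs.
have -> : (2 * expR (- 2) / Num.sqrt (pi *+ 2))%:E =
    (\int[lebesgue_measure]_(x in `[(- sigma)%R, sigma])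
      (cst (expR (- 2) * normal_peak sigma)%:E) x)%E.
  rewrite integral_cst//= lebesgue_measure_itv/= lte_fin.
  rewrite (_ : - sigma < sigma)%R; last lra.
  rewrite -EFinD -EFinM; congr EFin.
  rewrite /normal_peak -mulrnAr sqrtrM ?sqr_ge0// sqrtr_sqr gtr0_norm//.
  by field; rewrite (gt_eqF s0) andbT gt_eqF// sqrtr_gt0 mulrn_wgt0// pi_gt0.
rewrite /normal_prob; apply: ge0_le_integral => //.
- by move=> x _; rewrite lee_fin mulr_ge0 ?expR_ge0 ?normal_peak_ge0.
- apply: measurable_funTS; apply/measurable_EFinP; exact: measurable_normal_pdf.
- move=> x; rewrite /= in_itv/= -ler_norml => xs; rewrite lee_fin.
  exact: normal_pdf_lb.
Qed.

(* On [- sigma, sigma] the densities of two normal laws with means in that    *)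
(* interval differ at most by the factor expR 2, and the mass of either is at *)
(* least 2 * sigma times normal_peak sigma * expR (- 2).                      *)
Definition two_point_bound {R : realType} : R :=
  expR (- 2) * (2 * expR (- 2) / Num.sqrt (pi *+ 2)).

(** * The test between two means that differ in one entry *)

Section two_point.
Context {R : realType} {l m : nat} (i : 'I_l) (j : 'I_m).
Context (sigma : R) (M M' : 'M[R]_(l, m)) (mu mu' : probability 'M[R]_(l, m) R).
Context (sigma_gt0 : 0 < sigma) (muM : gaussian_law M sigma mu)
  (muM' : gaussian_law M' sigma mu')
  (MM' : forall k, k != (i, j) -> M k.1 k.2 = M' k.1 k.2).

Let slab := [set N : 'M[R]_(l, m) | N i j \in `[- sigma, sigma]].

Let measurable_slab : measurable slab.
Proof.
rewrite -[X in measurable X]setTI.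
exact: (measurable_mx_entry i j measurableT (measurable_itv `[- sigma, sigma])).
Qed.

(** Both laws arise from [mu] by resampling the entry [(i, j)], with means [M i j] and [M' i j], so
    [le_normal_prob] applies fibre by fibre. *)
Lemma gaussian_law_comparable B : `|M' i j| <= sigma -> measurable B ->
  B `<=` slab -> ((expR (- 2))%:E * mu B <= mu' B)%E.
Proof.
move=> M's mB Bs.
have mS : measurable (set_entry i j @^-1` B).
  by rewrite -[X in measurable X]setTI; exact: measurable_set_entry.
have mf c : measurable_fun setT (fun N : 'M[R]_(l, m) =>
    normal_prob c sigma (ysection (set_entry i j @^-1` B) N)).
  exact: (measurable_fun_ysection (normal_prob c sigma) mS).
rewrite (gaussian_law_resample (i := i) (j := j) (fun _ _ => erefl) muM muM mB).
rewrite [leRHS](gaussian_law_resample MM' muM muM' mB).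
rewrite -ge0_integralZl//.
apply: ge0_le_integral => //.
- by move=> N _; rewrite mule_ge0// lee_fin expR_ge0.
- apply: emeasurable_funM => //; exact: mf.
- move=> N _; apply: le_normal_prob => //; first exact: measurable_ysection.
  move=> x; rewrite /ysection/= inE => /Bs.
  by rewrite /slab/= mxE eqxx.
Qed.

Lemma gaussian_law_slab : `|M i j| <= sigma ->
  ((2 * expR (- 2) / Num.sqrt (pi *+ 2))%:E <= mu slab)%E.
Proof.
move=> Ms.
pose A k := if k == (i, j) then `[- sigma, sigma]%classic else [set: R].
have -> : slab = box A.
  apply/seteqP; split => N /=; rewrite /slab/= => h.
    by move=> k; rewrite /A; case: eqP => // ->.
  by have := h (i, j); rewrite /A eqxx.
have mA k : measurable (A k) by rewrite /A; case: ifP.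
rewrite muM// (bigD1 (i, j))//= big1 ?mule1 => [|k kij]; last first.
  by rewrite /A (negPf kij) probability_setT.
by rewrite /A eqxx; exact: normal_prob_ball.
Qed.

Lemma two_point_error D : `|M i j| <= sigma -> `|M' i j| <= sigma ->
  measurable D ->
  (two_point_bound%:E <= mu D + mu' (~` D))%E.
Proof.
move=> Ms M's mD.
have mD1 : measurable (D `&` slab) by exact: measurableI.
have mD2 : measurable (~` D `&` slab).
  by apply: measurableI => //; exact: measurableC.
have : (two_point_bound%:E <= (expR (- 2))%:E * mu slab)%E.
  rewrite EFinM lee_wpmul2l ?lee_fin ?expR_ge0//; exact: gaussian_law_slab.
move=> /le_trans; apply.
have -> : mu slab = (mu (D `&` slab) + mu (~` D `&` slab))%E.
  rewrite -measureU//; first by rewrite -setIUl setUv setTI.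
  by rewrite setIACA setICr set0I.
rewrite ge0_muleDr//; apply: leeD.
  apply: (@le_trans _ _ (mu (D `&` slab))); last first.
    by apply: le_measure; rewrite ?inE//; exact: subIsetl.
  rewrite -[leRHS]mul1e lee_wpmul2r// lee_fin -[leRHS]expR0 ler_expR; lra.
apply: (@le_trans _ _ (mu' (~` D `&` slab))).
  by apply: gaussian_law_comparable => //; exact: subIsetr.
by apply: le_measure; rewrite ?inE//; exact: measurableC.
Qed.

End two_point.

(** * Sign patterns and the number of wrong signs *)

Section sign_hypotheses.
Context {R : realType} {l m : nat} (n : nat) (sigma : R).
Context (sigma_gt0 : 0 < sigma).
Implicit Types (e : {ffun 'I_l * 'I_m -> bool}) (k : 'I_l * 'I_m).

Definition top_rows : {pred 'I_l * 'I_m} :=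
  [pred k : 'I_l * 'I_m | (k.1 < n)%N].

Definition sign_mx e : 'M[R]_(l, m) :=
  \matrix_(i, j) if (i < n)%N then (if e (i, j) then sigma else - sigma) else 0.

Definition flip k e := [ffun k' => if k' == k then ~~ e k' else e k'].

Lemma flipK k : involutive (flip k).
Proof.
by move=> e; apply/ffunP => k'; rewrite !ffunE; case: eqP; rewrite ?negbK.
Qed.

Lemma sign_mx_flip k e k' : k' != k ->
  sign_mx e k'.1 k'.2 = sign_mx (flip k e) k'.1 k'.2.
Proof. by move=> k'k; rewrite !mxE !ffunE -surjective_pairing (negPf k'k). Qed.

Lemma norm_sign_mx_le e i j : `|sign_mx e i j| <= sigma.
Proof.
rewrite mxE; case: ifP; [case: ifP|];
  by rewrite ?normrN ?normr0 ?gtr0_norm// ltW.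
Qed.

Context (Mtilde : {mfun 'M[R]_(l, m) >-> 'M[R]_(l, m)}).

(** A zero estimate counts as positive, so that exactly one of the two signs is wrong and flipping
    [e] at [k] gives the complement. *)
Definition wrong_sign e k : set 'M[R]_(l, m) :=
  [set N | (0 <= Mtilde N k.1 k.2) != e k].

Lemma measurable_wrong_sign e k : measurable (wrong_sign e k).
Proof.
have mk : measurable [set N | 0 <= Mtilde N k.1 k.2].
  have mf : measurable_fun setT (fun N : 'M[R]_(l, m) => Mtilde N k.1 k.2).
    exact: measurableT_comp (measurable_mx_entry _ _) _.
  have := mf measurableT _ (measurable_itv `[0, +oo[); rewrite setTI.
  by congr measurable; apply/seteqP; split => N /=; rewrite in_itv/= andbT.
rewrite /wrong_sign; case: (e k).
  rewrite (_ : [set _ | _] = ~` [set N | 0 <= Mtilde N k.1 k.2]).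
    exact: measurableC.
  by apply/seteqP; split => N /=; case: (0 <= _).
rewrite (_ : [set _ | _] = [set N | 0 <= Mtilde N k.1 k.2])//.
by apply/seteqP; split => N /=; case: (0 <= _).
Qed.

Lemma wrong_sign_flip e k : wrong_sign (flip k e) k = ~` wrong_sign e k.
Proof.
by rewrite /wrong_sign; apply/seteqP; split => N /=; rewrite ffunE eqxx;
  case: (0 <= _); case: (e k).
Qed.

(** A number of the wrong sign is at distance at least [sigma] from the true entry; the other
    entries contribute nonnegative terms. *)
Lemma sqr_hs_norm_wrong_sign e N :
  sigma ^+ 2 * (\sum_(k in top_rows) \1_(wrong_sign e k) N : R) <=
  hs_norm (Mtilde N - sign_mx e) ^+ 2.
Proof.
rewrite /hs_norm sqr_sqrtr; last first.
  by apply: sumr_ge0 => i _; apply: sumr_ge0 => j _; rewrite sqr_ge0.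
rewrite pair_big/= [leRHS](bigID top_rows)/=.
rewrite ler_wpDr// ?sumr_ge0// => [k _|]; first exact: sqr_ge0.
rewrite mulr_sumr ler_sum// => k; rewrite inE => kn; rewrite indicE.
have -> : (N \in wrong_sign e k) = ((0 <= Mtilde N k.1 k.2) != e k).
  by apply/idP/idP; rewrite inE.
have s0 := sigma_gt0; rewrite !mxE kn -surjective_pairing.
have [t0|t0] := leP 0 (Mtilde N k.1 k.2); case: (e k) => /=;
  rewrite ?mulr1 ?mulr0 ?sqr_ge0//.
  by rewrite opprK lerXn2r ?nnegrE//; lra.
by rewrite -[leRHS]sqrrN lerXn2r ?nnegrE; lra.
Qed.

Lemma risk_wrong_sign e d (Omega : measurableType d) (P : probability Omega R)
    (Y : {RV P >-> 'M[R]_(l, m)}) :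
  ((sigma ^+ 2)%:E * \sum_(k in top_rows) distribution P Y (wrong_sign e k) <=
   'E_P[fun w => (hs_norm (Mtilde (Y w) - sign_mx e) ^+ 2)%R])%E.
Proof.
have mYw k : measurable (Y @^-1` wrong_sign e k).
  rewrite -[X in measurable X]setTI; apply: measurable_funPT => //.
  exact: measurable_wrong_sign.
have mI k : measurable_fun setT (fun w => \1_(wrong_sign e k) (Y w) : R).
  exact: (measurable_indic (mYw k)).
have mH :
    measurable_fun setT (fun w => hs_norm (Mtilde (Y w) - sign_mx e) ^+ 2).
  rewrite (_ : (fun _ => _) = fun w => \sum_(i < l) \sum_(j < m)
      (Mtilde (Y w) i j - sign_mx e i j) ^+ 2).
    apply: measurable_sum => i; apply: measurable_sum => j.
    apply: measurable_funX; apply: measurable_funB => //.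
    apply: (measurableT_comp (measurable_mx_entry i j)).
    exact: measurableT_comp.
  apply/funext => w; rewrite sqr_sqrtr.
    by apply: eq_bigr => i _; apply: eq_bigr => j _; rewrite !mxE.
  by apply: sumr_ge0 => i _; apply: sumr_ge0 => j _; rewrite sqr_ge0.
rewrite expectation.unlock.
rewrite -big_enum/=.
have -> : ((sigma ^+ 2)%:E *
    \sum_(k <- enum top_rows) distribution P Y (wrong_sign e k) =
    \int[P]_w (sigma ^+ 2 *
      (\sum_(k <- enum top_rows) \1_(wrong_sign e k) (Y w)))%:E)%E.
  under eq_integral do rewrite EFinM -sumEFin.
  rewrite ge0_integralZl//; last 3 first.
  - apply: emeasurable_sum => k; exact/measurable_EFinP/mI.
  - by move=> w _; rewrite sume_ge0// => k _; rewrite lee_fin indicE.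
  - by rewrite lee_fin sqr_ge0.
  rewrite ge0_integral_sum//; last by move=> k; exact/measurable_EFinP/mI.
  congr (_ * _)%E; apply: eq_bigr => k _.
  rewrite -[RHS]/(\int[P]_w (\1_(Y @^-1` wrong_sign e k) w)%:E)%E.
  by rewrite integral_indic// setIT.
apply: ge0_le_integral => //.
- move=> w _; rewrite lee_fin mulr_ge0 ?sqr_ge0// sumr_ge0//.
- apply/measurable_EFinP/measurable_funM => //; exact: measurable_sum.
- exact/measurable_EFinP.
- by move=> w _; rewrite lee_fin big_enum; exact: sqr_hs_norm_wrong_sign.
Qed.

(* Averaged over all sign patterns, [e] and [flip k e] pair up into two-point *)
(* problems, so some pattern has at least the average number of wrong signs.  *)
Lemma exists_wrong_signs : exists e, forall mu : probability 'M[R]_(l, m) R,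
  gaussian_law (sign_mx e) sigma mu ->
  ((#|top_rows|%:R * two_point_bound / 2)%:E <=
   \sum_(k in top_rows) mu (wrong_sign e k))%E.
Proof.
(* The contradiction hypothesis itself supplies a Gaussian law [mu e] for every pattern, so no such
   law has to be constructed. *)
apply: contrapT => H; set X := #|_|%:R * _ / 2 in H.
have : forall e, exists mu : probability 'M[R]_(l, m) R,
    gaussian_law (sign_mx e) sigma mu /\
    (\sum_(k in top_rows) mu (wrong_sign e k) < X%:E)%E.
  move=> e; apply: contrapT => h; apply: H; exists e => mu mue.
  by rewrite leNgt; apply/negP => lt; apply: h; exists mu.
case/choice => mu hmu; pose q e k := fine (mu e (wrong_sign e k)).
have qE e k : mu e (wrong_sign e k) = (q e k)%:E.
  by rewrite fineK// fin_num_measure//; exact: measurable_wrong_sign.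
have qX e : \sum_(k in top_rows) q e k < X.
  have [_] := hmu e; rewrite (eq_bigr _ (fun k _ => qE e k)).
  by rewrite sumEFin lte_fin.
have q_flip e k : two_point_bound <= q e k + q (flip k e) k.
  have := two_point_error sigma_gt0 (hmu e).1 (hmu (flip k e)).1
    (fun k' => @sign_mx_flip _ e k') (norm_sign_mx_le e k.1 k.2)
    (norm_sign_mx_le (flip k e) k.1 k.2) (measurable_wrong_sign e k).
  by rewrite -wrong_sign_flip !qE -EFinD lee_fin.
have : \sum_e \sum_(k in top_rows) q e k <
    \sum_(e : {ffun 'I_l * 'I_m -> bool}) X.
  apply: ltr_sum => //; apply/hasP.
  by exists [ffun=> true]; rewrite ?mem_index_enum.
rewrite ltNge => /negP; apply.
rewrite exchange_big/= -(ler_pM2r (ltr0n _ 2)) mulr_suml.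
rewrite [leLHS](_ : _ = \sum_(k in top_rows)
    \sum_(e : {ffun 'I_l * 'I_m -> bool}) two_point_bound); last first.
  rewrite !sumr_const -mulrnA mulnC mulrnA -[in RHS]mulr_natl /X -mulrnAl.
  by field.
rewrite mulr_suml; apply: ler_sum => k _.
(* Twice the sum over patterns is a sum over the pairs [e], [flip k e]. *)
rewrite mulr_natr mulr2n [X in _ <= X + _](reindex_inj (inv_inj (flipK k)))/=.
rewrite addrC -big_split; apply: ler_sum => e _; exact: q_flip.
Qed.

(** * Rank and norms of the sign matrices *)

Lemma card_top_rows : (n <= l)%N -> #|top_rows| = (n * m)%N.
Proof.
move=> nl; rewrite [LHS](_ : _ = #|[predX [pred i : 'I_l | (i < n)%N] & 'I_m]|).
  rewrite cardX card_ord -sum1_card; congr (_ * _)%N.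
  under eq_bigl do rewrite inE.
  by rewrite (big_ord_narrow nl) sum1_card card_ord.
by apply: eq_card => k; rewrite !inE andbT.
Qed.

Lemma mxrank_sign_mx_le e : (n <= l)%N -> (\rank (sign_mx e) <= n)%N.
Proof.
move=> nl; rewrite [sign_mx e](_ : _ = (pid_mx n : 'M[R]_l) *m sign_mx e).
  by rewrite (leq_trans (mxrankM_maxl _ _))// rank_pid_mx.
apply/matrixP => i j; rewrite [RHS]mxE (bigD1 i)//= big1 ?addr0 => [|i' i'i].
  by rewrite [X in X * _]mxE eqxx/= mxE; case: ifP => _; rewrite ?mul1r ?mul0r.
by rewrite [X in X * _]mxE (inj_eq val_inj) eq_sym (negPf i'i) mul0r.
Qed.

Lemma hs_norm_sign_mx e : (n <= l)%N ->
  hs_norm (sign_mx e) = Num.sqrt (n%:R * m%:R) * sigma.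
Proof.
move=> nl; rewrite /hs_norm pair_big/= (bigID (mem top_rows))/=.
rewrite [X in _ + X]big1 => [|k].
  rewrite addr0 (eq_bigr (fun=> sigma ^+ 2)) => [|k]; last first.
    by rewrite inE => kn; rewrite mxE kn; case: ifP; rewrite ?sqrrN.
  rewrite sumr_const card_top_rows// -[_ *+ (n * m)]mulr_natl natrM.
  by rewrite [LHS]sqrtrM ?mulr_ge0// sqrtr_sqr gtr0_norm.
by rewrite inE => /negPf kn; rewrite mxE kn expr0n.
Qed.

Lemma nuclear_norm_sign_mx e : (n <= l)%N -> (l <= m)%N ->
  nuclear_norm (sign_mx e) <= n%:R * Num.sqrt m%:R * sigma.
Proof.
move=> nl lm; apply: le_trans (nuclear_norm_le_rank _ lm) _.
rewrite hs_norm_sign_mx// sqrtrM// !mulrA.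
rewrite ler_wpM2r ?(ltW sigma_gt0)// ler_wpM2r ?sqrtr_ge0//.
rewrite -[leRHS]sqr_sqrtr// expr2 ler_wpM2r ?sqrtr_ge0// ler_wsqrtr// ler_nat.
exact: mxrank_sign_mx_le.
Qed.

End sign_hypotheses.

(** * Choice of the number of rows and of the constant *)

Theorem theorem3p2 (R : realType) :
  exists C : R, 0 < C /\
  forall (l m : nat) (sigma delta : R),
    (0 < l)%N -> (0 < m)%N -> (l <= m)%N -> 0 < sigma -> 0 <= delta ->
    let s := delta * (Num.sqrt l%:R + Num.sqrt m%:R) / (l%:R * m%:R * sigma) in
    2 / l%:R <= s -> s <= 1 ->
  forall Mtilde : {mfun 'M[R]_(l, m) >-> 'M[R]_(l, m)},
  exists M : 'M[R]_(l, m), nuclear_norm M <= delta /\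
  forall (d : measure_display) (Omega : measurableType d)
         (P : probability Omega R) (Y : {RV P >-> 'M[R]_(l, m)}),
    gaussian_matrix M sigma Y ->
    ((C * s)%:E <= 'E_P[fun w => (hs_norm (Mtilde (Y w) - M) ^+ 2)%R]
                   / (l%:R * m%:R * sigma ^+ 2)%:E)%E.
Proof.
have tpb_gt0 : 0 < two_point_bound :> R.
  by rewrite !mulr_gt0 ?expR_gt0// invr_gt0 sqrtr_gt0 mulrn_wgt0// pi_gt0.
(* A factor 2 is lost in averaging over the two signs and a factor 4 in [s * l <= 4 * n]. *)
exists (two_point_bound / 8); split; first by rewrite divr_gt0.
move=> l m sigma delta l0 m0 lm s0 d0 s.
have sE : s =
    delta * (Num.sqrt l%:R + Num.sqrt m%:R) / (l%:R * m%:R * sigma) by [].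
move: s sE => s sE s_ge s_le Mt.
have l0R : 0 < l%:R :> R by rewrite ltr0n.
have m0R : 0 < m%:R :> R by rewrite ltr0n.
have sl : 2 <= s * l%:R by rewrite -ler_pdivrMr.
have x0 : 0 <= s * l%:R / 2 by lra.
have /andP[nx xn] := truncn_itv x0.
move: (Num.truncn _) nx xn => n nx; rewrite -[n.+1%:R]natr1 => xn.
have n1 : 1 <= n%:R :> R.
  rewrite ler1n lt0n; apply: contraTneq xn => ->; rewrite -leNgt; lra.
have nl : (n <= l)%N by rewrite -(ler_nat R); nra.
(* As [n] is at least 1, [s * l / 2 < n + 1 <= 2 * n]; this is where [2 / l <= s] enters. *)
have ns : s * l%:R <= 4 * n%:R by lra.
have [e he] := exists_wrong_signs n s0 Mt.
exists (sign_mx n sigma e); split.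
  apply: le_trans (nuclear_norm_sign_mx _ _ _ _) _ => //.
  have dE : delta * (Num.sqrt l%:R + Num.sqrt m%:R) = s * l%:R * m%:R * sigma.
    by rewrite sE; field; rewrite !gt_eqF.
  have sm0 : 0 < Num.sqrt m%:R :> R by rewrite sqrtr_gt0.
  have smm : Num.sqrt m%:R ^+ 2 = m%:R :> R by rewrite sqr_sqrtr.
  have slm : Num.sqrt l%:R <= Num.sqrt m%:R :> R.
    by rewrite ler_wsqrtr// ler_nat.
  (* After this scaling, [s * l * m * sigma] fits between the two sides: above the left one as
     [2 * n <= s * l], below the right one as [Num.sqrt l%:R <= Num.sqrt m%:R]. *)
  rewrite -(ler_pM2r (_ : 0 < Num.sqrt m%:R *+ 2)) ?mulrn_wgt0//.
  apply: (@le_trans _ _ (s * l%:R * m%:R * sigma)).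
    rewrite [leLHS](_ : _ = n%:R * 2 * Num.sqrt m%:R ^+ 2 * sigma); last first.
      by ring.
    rewrite smm !ler_wpM2r ?(ltW s0) ?(ltW m0R)//; lra.
  by rewrite -dE ler_wpM2l// mulr2n lerD2r.
move=> d Omega P Y /gaussian_matrix_law /he => {}he.
have lms0 : 0 < l%:R * m%:R * sigma ^+ 2 by rewrite !mulr_gt0// exprn_gt0.
rewrite inver gt_eqF// lee_pdivlMr//.
apply: le_trans (risk_wrong_sign n s0 _ _ _).
apply: le_trans (lee_wpmul2l _ he); last by rewrite lee_fin sqr_ge0.
rewrite card_top_rows// -!EFinM lee_fin natrM.
pose c := m%:R * two_point_bound * sigma ^+ 2 / 8.
rewrite [leLHS](_ : _ = (s * l%:R) * c); last by rewrite /c; ring.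
rewrite [leRHS](_ : _ = (4 * n%:R) * c); last by rewrite /c; field.
by rewrite ler_wpM2r// !mulr_ge0 ?sqr_ge0// ltW.
Qed.
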